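(* Let $\Bbbk$ be a field. Let $S$ be a finite semigroup, let $E$ be a set of idempotents of $S$, and assume that $S$ is a reduced $E$-Fountain semigroup which satisfies the congruence condition and the generalized right ample identity. Assume that the relation $\trianglelefteq_{l}$ on $S$ is contained in a partial order. Then for every $e\in E$ there is an isomorphism of left $\Bbbk S$-modules $\Bbbk\widetilde{\mathcal{L}}_E(e)\simeq\Bbbk\mathcal{C}(S)\cdot C(e)$. In particular, $\Bbbk\widetilde{\mathcal{L}}_E(e)$ is a projective $\Bbbk S$-module for every $e\in E$, and $\Bbbk S\simeq\bigoplus_{e\in E}\Bbbk\widetilde{\mathcal{L}}_E(e)$ as left $\Bbbk S$-modules.
   Context: For a semigroup $S$ and a subset $E$ of idempotents of $S$, define equivalence relations on $S$: $a\,\widetilde{\mathcal{L}}_E\,b$ iff for all $e\in E$ ($ae=a\iff be=b$); $a\,\widetilde{\mathcal{R}}_E\,b$ iff for all $e\in E$ ($ea=a\iff eb=b$). $S$ is $E$-Fountain if every $\widetilde{\mathcal{L}}_E$-class and every $\widetilde{\mathcal{R}}_E$-class contains an element of $E$. It is reduced if moreover $ef=e\iff fe=e$ for all $e,f\in E$. In that case each $\widetilde{\mathcal{L}}_E$-class (resp. $\widetilde{\mathcal{R}}_E$-class) contains a unique element of $E$; the one in the $\widetilde{\mathcal{L}}_E$-class (resp. $\widetilde{\mathcal{R}}_E$-class) of $a\in S$ is denoted $a^{\ast}$ (resp. $a^{+}$). $S$ satisfies the congruence condition if $\widetilde{\mathcal{L}}_E$ is a right congruence and $\widetilde{\mathcal{R}}_E$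 is a left congruence; equivalently $(ab)^{\ast}=(a^{\ast}b)^{\ast}$ and $(ab)^{+}=(ab^{+})^{+}$ for all $a,b\in S$. The generalized right ample identity holds in $S$ if $\left(e\left(a(eaf)^{\ast}\right)^{+}\right)^{\ast}=\left(a(eaf)^{\ast}\right)^{+}$ for all $a\in S$ and $e,f\in E$. The relation $\trianglelefteq_{l}$ on $S$: $a\trianglelefteq_{l}b$ iff $a=be$ for some $e\in E$. The category $\mathcal{C}(S)$: its objects are the elements of $E$; its morphisms are in one-to-one correspondence with elements of $S$, where $a\in S$ corresponds to a morphism $C(a)$ with domain $a^{\ast}$ and range $a^{+}$; if $b^{\ast}=a^{+}$ the composition is $C(b)\cdot C(a)=C(ba)$. The category algebra $\Bbbk\mathcal{C}(S)$ is the vector space with basis the morphisms, with product of two morphisms $m'\cdot m$ equal to their composition $m'm$ if defined and $0$ otherwise. $\Bbbk S$ is the semigroup algebra. Under the stated hypotheses the linear map $\varphi:\Bbbk S\to\Bbbk\mathcal{C}(S)$, $\varphi(a)=\sum_{c\trianglelefteq_{l}a}C(c)$ for $a\in S$, is known to be an isomorphism of $\Bbbk$-algebras (so $\Bbbk S$ is unital). Every left $\Bbbk\mathcal{C}(S)$-module $M$ (in particular the left ideal $\Bbbk\mathcal{C}(S)\cdot C(e)$) is regarded as a left $\Bbbk S$-module via $s\star m=\varphi(s)\cdot m$. For $e\in E$, $\widetilde{\mathcal{L}}_E(e)$ is the $\widetilde{\mathcal{L}}_E$-class of $e$, and $\Bbbk\widetilde{\mathcal{L}}_E(e)$ is the $\Bbbk$-vector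 space with basis $\widetilde{\mathcal{L}}_E(e)$, a left $\Bbbk S$-module via the linear extension of: $s\cdot x=sx$ if $sx\in\widetilde{\mathcal{L}}_E(e)$, and $s\cdot x=0$ otherwise ($s\in S$, $x\in\widetilde{\mathcal{L}}_E(e)$). *)

(* Defs.v *)
From HB Require Import structures.
From mathcomp Require Import all_boot all_order all_algebra.
From mathcomp Require Import boolp.

Set Implicit Arguments.
Unset Strict Implicit.
Unset Printing Implicit Defensive.

Import GRing.Theory.
Local Open Scope ring_scope.

Definition lmod_iso (R : pzRingType) (M N : lmodType R) : Prop :=
  exists f : {linear M -> N}, bijective f.

Definition projective (R : pzRingType) (M : lmodType R) : Prop :=
  forall (N N' : lmodType R) (g : {linear N -> N'}) (f : {linear M -> N'}),
    (forall y, exists x, g x = y) ->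
    exists h : {linear M -> N}, forall m, g (h m) = f m.

Section LeftIdeal.
Variables (R : pzRingType) (x : R).

Definition left_ideal_pred : {pred R^o} := fun y => `[< exists z : R, y = z * x >].

Fact left_ideal_submod : subsemimod_closed left_ideal_pred.
Proof.
split; first split.
- by apply/asboolP; exists 0; rewrite mul0r.
- move=> u v /asboolP[a ->] /asboolP[b ->].
  by apply/asboolP; exists (a + b); rewrite mulrDl.
- move=> c u /asboolP[a ->]; apply/asboolP; exists (c * a).
  by rewrite -mulrA.
Qed.

HB.instance Definition _ :=
  GRing.isSubmodClosed.Build R R^o left_ideal_pred left_ideal_submod.

Record left_ideal := LeftIdeal {
  left_ideal_val :> R^o;
  _ : left_ideal_val \in left_ideal_pred }.

HB.instance Definition _ := [isSub for left_ideal_val].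
HB.instance Definition _ := [Choice of left_ideal by <:].
HB.instance Definition _ := [SubChoice_isSubLmodule of left_ideal by <:].

End LeftIdeal.

Definition restrict (R R' : pzRingType) (f : {rmorphism R -> R'})
  (M : lmodType R') : Type := M.

Section Restrict.
Variables (R R' : pzRingType) (f : {rmorphism R -> R'}) (M : lmodType R').

HB.instance Definition _ := GRing.Zmodule.copy (restrict f M) M.

Definition restrict_scale (s : R) (m : restrict f M) : restrict f M :=
  f s *: (m : M).

Fact restrict_scalerA a b v :
  restrict_scale a (restrict_scale b v) = restrict_scale (a * b) v.
Proof. by rewrite /restrict_scale rmorphM scalerA. Qed.
Fact restrict_scale1r : left_id 1 restrict_scale.
Proof. by move=> v; rewrite /restrict_scale rmorph1 scale1r. Qed.
Fact restrict_scalerDr : right_distributive restrict_scale +%R.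
Proof. by move=> a u v; rewrite /restrict_scale scalerDr. Qed.
Fact restrict_scalerDl v : {morph restrict_scale^~ v : a b / a + b}.
Proof. by move=> a b; rewrite /restrict_scale rmorphD scalerDl. Qed.

HB.instance Definition _ := GRing.Zmodule_isLmodule.Build R (restrict f M)
  restrict_scalerA restrict_scale1r restrict_scalerDr restrict_scalerDl.
End Restrict.

(** [I] is finite, so the direct sum is the full product. *)
Definition dsum (R : pzRingType) (I : finType) (M : I -> lmodType R) : Type :=
  {dffun forall i : I, M i}.

Section DirectSum.
Variables (R : pzRingType) (I : finType) (M : I -> lmodType R).
Local Notation D := (dsum M).
Implicit Types u v w : D.

HB.instance Definition _ := Choice.copy D {dffun forall i : I, M i}.

Definition dsum_zero : D := [ffun i => 0 : M i].
Definition dsum_opp u : D := [ffun i => - (u i) : M i].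
Definition dsum_add u v : D := [ffun i => u i + v i : M i].
Definition dsum_scale (a : R) u : D := [ffun i => a *: u i : M i].

Fact dsum_addA : associative dsum_add.
Proof. by move=> u v w; apply/ffunP=> i; rewrite !ffunE addrA. Qed.
Fact dsum_addC : commutative dsum_add.
Proof. by move=> u v; apply/ffunP=> i; rewrite !ffunE addrC. Qed.
Fact dsum_add0 : left_id dsum_zero dsum_add.
Proof. by move=> u; apply/ffunP=> i; rewrite !ffunE add0r. Qed.
Fact dsum_addN : left_inverse dsum_zero dsum_opp dsum_add.
Proof. by move=> u; apply/ffunP=> i; rewrite !ffunE addNr. Qed.

HB.instance Definition _ :=
  GRing.isZmodule.Build D dsum_addA dsum_addC dsum_add0 dsum_addN.

Fact dsum_scalerA a b u :
  dsum_scale a (dsum_scale b u) = dsum_scale (a * b) u.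
Proof. by apply/ffunP=> i; rewrite !ffunE scalerA. Qed.
Fact dsum_scale1r : left_id 1 dsum_scale.
Proof. by move=> u; apply/ffunP=> i; rewrite !ffunE scale1r. Qed.
Fact dsum_scalerDr : right_distributive dsum_scale +%R.
Proof. by move=> a u v; apply/ffunP=> i; rewrite !ffunE scalerDr. Qed.
Fact dsum_scalerDl u : {morph dsum_scale^~ u : a b / a + b}.
Proof. by move=> a b; apply/ffunP=> i; rewrite !ffunE scalerDl. Qed.

HB.instance Definition _ := GRing.Zmodule_isLmodule.Build R D
  dsum_scalerA dsum_scale1r dsum_scalerDr dsum_scalerDl.
End DirectSum.

Section Extension.
Variables (k : fieldType).
Implicit Types (A B : finType) (V : lmodType k).

Definition basis A (a : A) : {ffun A -> k^o} := [ffun b => (b == a)%:R].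

Definition linext A V (f : A -> V) (x : {ffun A -> k^o}) : V :=
  \sum_a x a *: f a.

Definition bilext A B V (f : A -> B -> V)
    (x : {ffun A -> k^o}) (y : {ffun B -> k^o}) : V :=
  \sum_a \sum_b (x a * y b) *: f a b.

Lemma basis_sum A (x : {ffun A -> k^o}) : x = \sum_a x a *: basis a.
Proof.
apply/ffunP=> b; rewrite sum_ffunE (bigD1 b) //= big1 ?addr0.
  by rewrite !ffunE eqxx /GRing.scale /= mulr1.
by move=> i ib; rewrite !ffunE eq_sym (negPf ib) /GRing.scale /= mulr0.
Qed.

Lemma linext_linear A V (f : A -> V) : linear (linext f).
Proof.
move=> c x y; rewrite /linext scaler_sumr -big_split /=; apply: eq_bigr=> a _.
by rewrite !ffunE scalerDl scalerA.
Qed.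
HB.instance Definition _ A V (f : A -> V) :=
  GRing.isLinear.Build k {ffun A -> k^o} V *:%R (linext f) (linext_linear f).

Lemma linext_basis A V (f : A -> V) a : linext f (basis a) = f a.
Proof.
rewrite /linext (bigD1 a) //= big1 ?addr0 ?ffunE ?eqxx ?scale1r //.
by move=> i ia; rewrite ffunE (negPf ia) scale0r.
Qed.

Lemma linext_sum A V (f : A -> V) (I : finType) (c : I -> k) F :
  linext f (\sum_i c i *: F i) = \sum_i c i *: linext f (F i).
Proof. by rewrite linear_sum; apply: eq_bigr=> i _; rewrite linearZ. Qed.

Lemma bilextr A B V (f : A -> B -> V) x y :
  bilext f x y = linext (fun b => linext (f^~ b) x) y.
Proof.
rewrite /bilext exchange_big /=; apply: eq_bigr=> b _.
by rewrite scaler_sumr; apply: eq_bigr=> a _; rewrite scalerA mulrC.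
Qed.

Lemma bilextl A B V (f : A -> B -> V) x y :
  bilext f x y = linext (fun a => linext (f a) y) x.
Proof.
apply: eq_bigr=> a _; rewrite scaler_sumr.
by apply: eq_bigr=> b _; rewrite scalerA.
Qed.

Lemma bilext_linearr A B V (f : A -> B -> V) x : linear (bilext f x).
Proof. by move=> c y z; rewrite !bilextr linearP. Qed.
HB.instance Definition _ A B V (f : A -> B -> V) x :=
  GRing.isLinear.Build k {ffun B -> k^o} V *:%R (bilext f x)
    (bilext_linearr f x).

Lemma bilext_linearl A B V (f : A -> B -> V) y : linear (bilext f ^~ y).
Proof. by move=> c x z; rewrite !bilextl linearP. Qed.

Lemma bilext_suml A B V (f : A -> B -> V) (I : finType) (c : I -> k) F y :
  bilext f (\sum_i c i *: F i) y = \sum_i c i *: bilext f (F i) y.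
Proof.
rewrite bilextl linear_sum; apply: eq_bigr=> i _.
by rewrite linearZ /= bilextl.
Qed.

Lemma bilext_sumr A B V (f : A -> B -> V) (I : finType) x (c : I -> k) F :
  bilext f x (\sum_i c i *: F i) = \sum_i c i *: bilext f x (F i).
Proof. by rewrite linear_sum; apply: eq_bigr=> i _; rewrite linearZ. Qed.

Lemma bilextDl A B V (f : A -> B -> V) x x' y :
  bilext f (x + x') y = bilext f x y + bilext f x' y.
Proof. by rewrite !bilextl linearD. Qed.

Lemma bilext0l A B V (f : A -> B -> V) y : bilext f 0 y = 0.
Proof. by rewrite !bilextl linear0. Qed.

Lemma bilext_basis A B V (f : A -> B -> V) a b :
  bilext f (basis a) (basis b) = f a b.
Proof. by rewrite bilextl !linext_basis. Qed.

Lemma bilextA (A B C D F : finType) V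
    (f : A -> B -> {ffun D -> k^o}) (g : D -> C -> V)
    (h : B -> C -> {ffun F -> k^o}) (l : A -> F -> V) :
  (forall a b c, bilext g (f a b) (basis c) = bilext l (basis a) (h b c)) ->
  forall x y z, bilext g (bilext f x y) z = bilext l x (bilext h y z).
Proof.
move=> fg x y z; rewrite (basis_sum x) !bilext_suml; apply: eq_bigr=> a _.
congr (_ *: _); rewrite (basis_sum y) bilext_sumr !bilext_suml bilext_sumr.
apply: eq_bigr=> b _; congr (_ *: _).
rewrite (basis_sum z) !bilext_sumr; apply: eq_bigr=> c _.
by congr (_ *: _); rewrite !bilext_basis fg.
Qed.

End Extension.

#[short(type="finSemigroupType")]
HB.structure Definition FinSemigroup := {S of Semigroup S & Finite S}.

Section Fountain.
Variables (S : finSemigroupType) (E : {set S}).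
Local Open Scope group_scope.
Implicit Types a b c : S.

Definition tildeL : rel S :=
  fun a b => [forall e in E, (a * e == a) == (b * e == b)].
Definition tildeR : rel S :=
  fun a b => [forall e in E, (e * a == a) == (e * b == b)].

Definition Fountain : Prop :=
  forall a, (exists2 e, e \in E & tildeL a e) /\ (exists2 e, e \in E & tildeR a e).

Definition reduced : Prop :=
  forall e f, e \in E -> f \in E -> (e * f = e <-> f * e = e).

Definition congruence_condition : Prop :=
  (forall a b c, tildeL a b -> tildeL (a * c) (b * c)) /\
  (forall a b c, tildeR a b -> tildeR (c * a) (c * b)).

(** [star a] and [plus a] are the elements of [E] in the classes of [a]; the
    default value is never used when [E]-Fountain holds, and the choice is
    unique when [E] is moreover reduced. *)
Definition star a : S := odflt a [pick e in E | tildeL a e].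
Definition plus a : S := odflt a [pick e in E | tildeR a e].

Definition generalized_right_ample : Prop :=
  forall a e f, e \in E -> f \in E ->
    star (e * plus (a * star (e * a * f))) = plus (a * star (e * a * f)).

Definition trianglel : rel S := fun a b => [exists e in E, a == b * e].

Definition in_partial_order (r : rel S) : Prop :=
  exists le : rel S,
    [/\ reflexive le, antisymmetric le, transitive le & subrel r le].

Record admissible : Prop := Admissible {
  adm_idem : forall e, e \in E -> e * e = e;
  adm_Fountain : Fountain;
  adm_reduced : reduced;
  adm_congruence : congruence_condition;
  adm_ample : generalized_right_ample;
  adm_order : in_partial_order trianglel }.

End Fountain.

Section FountainTheory.
Variables (S : finSemigroupType) (E : {set S}) (H : admissible E).
Local Open Scope group_scope.
Implicit Types a b c e : S.
Local Notation star := (star E).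
Local Notation plus := (plus E).

Lemma tildeLP a b :
  reflect (forall e, e \in E -> (a * e == a) = (b * e == b)) (tildeL E a b).
Proof.
apply: (iffP forallP) => h e; first by move=> eE; have /implyP/(_ eE)/eqP := h e.
by apply/implyP=> eE; rewrite h.
Qed.

Lemma tildeRP a b :
  reflect (forall e, e \in E -> (e * a == a) = (e * b == b)) (tildeR E a b).
Proof.
apply: (iffP forallP) => h e; first by move=> eE; have /implyP/(_ eE)/eqP := h e.
by apply/implyP=> eE; rewrite h.
Qed.

Lemma starP a : star a \in E /\ tildeL E a (star a).
Proof.
rewrite /Defs.star; case: pickP=> [e /andP[] //|].
by have [[e eE le] _] := adm_Fountain H a; move=> /(_ e); rewrite eE le.
Qed.

Lemma plusP a : plus a \in E /\ tildeR E a (plus a).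
Proof.
rewrite /Defs.plus; case: pickP=> [e /andP[] //|].
by have [_ [e eE le]] := adm_Fountain H a; move=> /(_ e); rewrite eE le.
Qed.

Lemma starE a : star a \in E. Proof. by case: (starP a). Qed.
Lemma plusE a : plus a \in E. Proof. by case: (plusP a). Qed.

Lemma star_le a e : e \in E -> (a * e == a) = (star a * e == star a).
Proof. by move=> eE; case: (starP a) => _ /tildeLP ->. Qed.
Lemma plus_le a e : e \in E -> (e * a == a) = (e * plus a == plus a).
Proof. by move=> eE; case: (plusP a) => _ /tildeRP ->. Qed.

Lemma mul_star a : a * star a = a.
Proof. by apply/eqP; rewrite star_le ?starE // (adm_idem H) ?starE. Qed.
Lemma plus_mul a : plus a * a = a.
Proof. by apply/eqP; rewrite plus_le ?plusE // (adm_idem H) ?plusE. Qed.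

Lemma E_anti e f : e \in E -> f \in E -> e * f = e -> f * e = f -> e = f.
Proof. by move=> eE fE ef fe; rewrite -fe; apply/esym/(adm_reduced H). Qed.

Lemma star_eq a b : tildeL E a b <-> star a = star b.
Proof.
split=> [/tildeLP h|h]; last by apply/tildeLP=> e eE; rewrite (star_le a) // (star_le b) // h.
apply: E_anti; rewrite ?starE //; apply/eqP; rewrite -star_le ?starE //.
  by rewrite h ?starE // mul_star.
by rewrite -h ?starE // mul_star.
Qed.

Lemma plus_eq a b : tildeR E a b <-> plus a = plus b.
Proof.
split=> [/tildeRP h|h]; last by apply/tildeRP=> e eE; rewrite (plus_le a) // (plus_le b) // h.
have hb : plus b * plus a = plus a.
  by apply/eqP; rewrite -plus_le ?plusE // h ?plusE // plus_mul.
have ha : plus a * plus b = plus b.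
  by apply/eqP; rewrite -plus_le ?plusE // -h ?plusE // plus_mul.
by apply: E_anti; rewrite ?plusE //; apply/(adm_reduced H); rewrite ?plusE.
Qed.

Lemma star_id e : e \in E -> star e = e.
Proof.
move=> eE; apply: E_anti; rewrite ?starE ?mul_star //.
by apply/eqP; rewrite -star_le // (adm_idem H).
Qed.

Lemma plus_id e : e \in E -> plus e = e.
Proof.
move=> eE; apply: E_anti; rewrite ?plusE //; apply/(adm_reduced H) => //;
  rewrite ?plusE ?plus_mul //.
by apply/eqP; rewrite -plus_le // (adm_idem H).
Qed.

Lemma star_mul a b : star (a * b) = star (star a * b).
Proof.
apply/star_eq; apply: (adm_congruence H).1.
by apply/star_eq; rewrite (star_id (starE a)).
Qed.

Lemma plus_mulr a b : plus (a * b) = plus (a * plus b).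
Proof.
apply/plus_eq; apply: (adm_congruence H).2.
by apply/plus_eq; rewrite (plus_id (plusE b)).
Qed.

Lemma star_comp a b : star a = plus b -> star (a * b) = star b.
Proof. by move=> h; rewrite star_mul h plus_mul. Qed.

Lemma plus_comp a b : star a = plus b -> plus (a * b) = plus a.
Proof. by move=> h; rewrite plus_mulr -h mul_star. Qed.

Lemma trianglelP c a : reflect (c = a * star c) (trianglel E c a).
Proof.
apply: (iffP existsP) => [[e /andP[eE /eqP ca]]|->]; last first.
  by exists (star c); rewrite starE /=; apply/eqP.
have ce : star c * e = star c.
  by apply/eqP; rewrite -star_le // ca -mulgA (adm_idem H).
have ec : e * star c = star c by apply/(adm_reduced H); rewrite ?starE.
by rewrite -ec mulgA -ca mul_star.
Qed.

Lemma star_suffix a b f : f \in E -> star (a * b) = f -> b * f = b -> star b = f.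
Proof.
move=> fE sab bf; apply: E_anti => //; first exact: starE.
  by apply/eqP; rewrite -star_le // bf.
apply/eqP; rewrite -sab -star_le ?starE //.
by rewrite -mulgA mul_star.
Qed.

(** [trianglel_mul] and [trianglel_split]: composing is a bijection from the
    composable pairs [(c, d)] with [c] below [a] and [d] below [b] to the
    elements below [a * b]; hence [phi] is multiplicative. *)
Lemma trianglel_mul a b c d : star c = plus d ->
  trianglel E c a -> trianglel E d b -> trianglel E (c * d) (a * b).
Proof.
move=> cd /trianglelP ca /trianglelP db; apply/trianglelP.
by rewrite star_comp // -mulgA -db ca -mulgA cd plus_mul.
Qed.

Lemma trianglel_split a b x : trianglel E x (a * b) ->
  let d := b * star x in let c := a * plus d in
  [/\ star c = plus d, trianglel E c a, trianglel E d b & c * d = x].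
Proof.
move=> /trianglelP xab d c.
have xE := starE x.
have sd : star d = star x.
  apply: (@star_suffix a); rewrite ?starE //; first by rewrite /d mulgA -xab.
  by rewrite /d -mulgA (adm_idem H).
have sc : star c = plus d.
  have := adm_ample H b (starE a) xE.
  have -> : star (star a * b * star x) = star x.
    by rewrite -mulgA -star_mul mulgA -xab.
  by rewrite -star_mul.
split=> //.
- by apply/trianglelP; rewrite sc.
- by apply/trianglelP; rewrite sd.
- by rewrite /c -mulgA plus_mul /d mulgA -xab.
Qed.

End FountainTheory.

(** Both algebras are free on [S]; the proof [H] is a parameter because associativity of
    the product on [catalg] and the unit of [semialg] depend on it. *)

Definition semialg (k : fieldType) (S : finSemigroupType) (E : {set S})
  (H : admissible E) : Type := {ffun S -> k^o}.

Definition catalg (k : fieldType) (S : finSemigroupType) (E : {set S})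
  (H : admissible E) : Type := {ffun S -> k^o}.

Section Algebras.
Variables (k : fieldType) (S : finSemigroupType) (E : {set S}).
Variable H : admissible E.
Local Notation kS := (semialg k H).
Local Notation kC := (catalg k H).
Local Notation star := (star E).
Local Notation plus := (plus E).

HB.instance Definition _ := GRing.Lmodule.copy kS {ffun S -> k^o}.
HB.instance Definition _ := GRing.Lmodule.copy kC {ffun S -> k^o}.

Definition sgelt (a : S) : kS := basis k a.
Definition mor (a : S) : kC := basis k a.

Definition semialg_mul : kS -> kS -> kS :=
  bilext (fun a b : S => sgelt (a * b)%g).

(** [mor a] goes from [star a] to [plus a], so [mor b] composes after [mor a]
    when [star b = plus a]. *)
Definition catalg_mul : kC -> kC -> kC :=
  bilext (fun b a : S => if star b == plus a then mor (b * a)%g else 0).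

Definition catalg_one : kC := \sum_(e in E) mor e.

Fact semialg_mulA : associative semialg_mul.
Proof.
move=> x y z; apply/esym; apply: bilextA => a b c.
by rewrite /sgelt !bilext_basis mulgA.
Qed.

Fact catalg_mulA : associative catalg_mul.
Proof.
move=> x y z; apply/esym; apply: bilextA => a b c; rewrite /mor.
case: (eqVneq (star a) (plus b)) => ab; case: (eqVneq (star b) (plus c)) => bc;
  rewrite ?bilext_basis ?bilext0l ?linear0 //=.
- by rewrite (star_comp H) // (plus_comp H) // bc ab !eqxx mulgA.
- by rewrite (star_comp H) // (negPf bc).
- by rewrite (plus_comp H) // (negPf ab).
Qed.

Fact catalg_mul1r : left_id catalg_one catalg_mul.
Proof.
move=> x; rewrite (basis_sum x) /catalg_mul bilext_sumr.
apply: eq_bigr => a _; congr (_ *: _).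
rewrite bilextl linear_sum (bigD1 (plus a)) ?(plusE H) //= big1 ?addr0.
  by rewrite !linext_basis (star_id H) ?(plusE H) // eqxx (plus_mul H).
move=> e /andP[eE ne]; rewrite !linext_basis (star_id H) //.
by rewrite (negPf ne).
Qed.

Fact catalg_mulr1 : right_id catalg_one catalg_mul.
Proof.
move=> x; rewrite (basis_sum x) /catalg_mul bilext_suml.
apply: eq_bigr => a _; congr (_ *: _).
rewrite linear_sum (bigD1 (star a)) ?(starE H) //= big1 ?addr0.
  by rewrite bilext_basis (plus_id H) ?(starE H) // eqxx (mul_star H).
move=> e /andP[eE ne]; rewrite bilext_basis (plus_id H) //.
by rewrite eq_sym (negPf ne).
Qed.

Fact catalg_mulDl : left_distributive catalg_mul +%R.
Proof. by move=> x y z; rewrite /catalg_mul bilextDl. Qed.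
Fact catalg_mulDr : right_distributive catalg_mul +%R.
Proof. by move=> x y z; rewrite /catalg_mul linearD. Qed.

HB.instance Definition _ := GRing.Zmodule_isPzRing.Build kC catalg_mulA
  catalg_mul1r catalg_mulr1 catalg_mulDl catalg_mulDr.

Definition phi : kS -> kC :=
  linext (fun a : S => \sum_(c | trianglel E c a) mor c).

HB.instance Definition _ := GRing.Linear.on phi.

Lemma phi_sgelt a : phi (sgelt a) = \sum_(c | trianglel E c a) mor c.
Proof. by rewrite /phi /sgelt linext_basis. Qed.

Lemma phi_mul_sgelt a b :
  catalg_mul (phi (sgelt a)) (phi (sgelt b)) = phi (sgelt (a * b)%g).
Proof.
rewrite !phi_sgelt /catalg_mul.
transitivity (\sum_(p : S * S | [&& trianglel E p.1 a, trianglel E p.2 b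
     & star p.1 == plus p.2]) mor (p.1 * p.2)%g).
  rewrite bilextl linear_sum.
  under eq_bigr=> c _ do rewrite /= linext_basis linear_sum /=.
  rewrite pair_big_dep /= big_mkcond /= [RHS]big_mkcond /=.
  apply: eq_bigr => -[c d] _ /=; rewrite linext_basis.
  by case: (trianglel E c a); case: (trianglel E d b).
rewrite (reindex_onto
  (fun x => let d := (b * star x)%g in ((a * plus d)%g, d))
  (fun p => (p.1 * p.2)%g)); last first.
  move=> [c d] /and3P[/= /(trianglelP H) ca /(trianglelP H) db /eqP cd].
  have sx : star (c * d)%g = star d by rewrite (star_comp H).
  by rewrite sx -db -cd -ca.
apply: eq_big => [x|x] /=.
  apply/andP/idP => [[/and3P[ca db /eqP cd] /eqP xE]|/(trianglel_split H) []].
    rewrite -xE; exact: (trianglel_mul H).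
  by move=> cd ca db xE; rewrite ca db cd xE !eqxx.
by case/andP=> _ /eqP ->.
Qed.

Lemma phi_semialg_mul x y :
  phi (semialg_mul x y) = catalg_mul (phi x) (phi y).
Proof.
rewrite (basis_sum x) /semialg_mul /catalg_mul /phi bilext_suml !linext_sum.
rewrite bilext_suml; apply: eq_bigr => a _; congr (_ *: _).
rewrite (basis_sum y) bilext_sumr !linext_sum bilext_sumr.
apply: eq_bigr => b _; congr (_ *: _).
by rewrite bilext_basis; apply/esym/phi_mul_sgelt.
Qed.

Lemma phiE x c : phi x c = \sum_a x a * (trianglel E c a)%:R.
Proof.
rewrite [LHS]sum_ffunE; apply: eq_bigr => a _; rewrite ffunE.
congr (_ * _); rewrite [LHS]sum_ffunE.
case: (boolP (trianglel E c a)) => [ca|nca].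
  rewrite (bigD1 c) //= big1 ?addr0 ?ffunE ?eqxx // => d /andP[_ dc].
  by rewrite ffunE eq_sym (negPf dc).
rewrite big1 // => d da; rewrite ffunE.
by case: eqP => // cd; rewrite cd da in nca.
Qed.

Lemma phi_inj : injective phi.
Proof.
have [le [lexx leA leT tle]] := adm_order H.
apply: raddf_inj => x px0; apply/eqP/negP => /negP x0.
have [a0 xa0] : exists a, x a != 0.
  apply/existsP; rewrite -negb_forall; apply: contra x0 => /forallP h.
  by apply/eqP/ffunP=> a; rewrite ffunE; apply/eqP.
pose up a := [set b | le a b].
have [a xa amin] := @arg_minnP _ a0 (fun a => x a != 0) (fun a => #|up a|) xa0.
have : phi x a = x a.
  rewrite phiE (bigD1 a) //= big1 ?addr0 => [|b ba].
    suff -> : trianglel E a a by rewrite mulr1.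
    by apply/(trianglelP H); rewrite (mul_star H).
  case: (eqVneq (x b) 0) => [->|xb]; first by rewrite mul0r.
  case: (boolP (trianglel E a b)) => [/tle leab|_]; last by rewrite mulr0.
  suff /proper_card : up b \proper up a by rewrite ltnNge (amin _ xb).
  apply/properP; split.
    by apply/subsetP=> z; rewrite !inE; apply: leT.
  exists a; rewrite !inE ?lexx //; apply: contra ba => leba.
  by apply/eqP/leA; rewrite leba leab.
by rewrite px0 ffunE => /esym/eqP; apply/negP.
Qed.

Lemma phi_surj y : exists x, phi x == y.
Proof.
pose f := linfun (phi : {ffun S -> k^o} -> {ffun S -> k^o}).
have kf : lker f == 0%VS.
  by apply/lker0P => u v; rewrite !lfunE => /phi_inj.
have := memvf (y : {ffun S -> k^o}).
have -> : fullv = limg f.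
  apply/esym/eqP; rewrite eqEdim subvf /=.
  by rewrite limg_dim_eq // (eqP kf) capv0.
by case/memv_imgP=> x _ ->; exists x; rewrite lfunE eqxx.
Qed.

(** [S] need not have an identity; the unit of its algebra is the preimage of
    the unit of the category algebra under the bijection [phi]. *)
Definition semialg_one : kS := xchoose (phi_surj 1).

Lemma phi_one : phi semialg_one = 1.
Proof. exact: eqP (xchooseP (phi_surj 1)). Qed.

Fact semialg_mul1r : left_id semialg_one semialg_mul.
Proof.
by move=> x; apply: phi_inj; rewrite phi_semialg_mul phi_one catalg_mul1r.
Qed.
Fact semialg_mulr1 : right_id semialg_one semialg_mul.
Proof.
by move=> x; apply: phi_inj; rewrite phi_semialg_mul phi_one catalg_mulr1.
Qed.
Fact semialg_mulDl : left_distributive semialg_mul +%R.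
Proof. by move=> x y z; rewrite /semialg_mul bilextDl. Qed.
Fact semialg_mulDr : right_distributive semialg_mul +%R.
Proof. by move=> x y z; rewrite /semialg_mul linearD. Qed.

HB.instance Definition _ := GRing.Zmodule_isPzRing.Build kS semialg_mulA
  semialg_mul1r semialg_mulr1 semialg_mulDl semialg_mulDr.

Fact phi_monoid_morphism : monoid_morphism phi.
Proof. by split; [exact: phi_one | exact: phi_semialg_mul]. Qed.

HB.instance Definition _ :=
  GRing.isMonoidMorphism.Build kS kC phi phi_monoid_morphism.

End Algebras.

Arguments phi k {S E} H _.

Definition Lclass (S : finSemigroupType) (E : {set S}) (e : S) : finType :=
  {x : S | tildeL E x e}.

Definition LclassModule (k : fieldType) (S : finSemigroupType) (E : {set S})
  (H : admissible E) (e : S) : Type := {ffun Lclass E e -> k^o}.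

Section LclassModule.
Variables (k : fieldType) (S : finSemigroupType) (E : {set S}).
Variables (H : admissible E) (e : S).
Local Notation kS := (semialg k H).
Local Notation kL := (LclassModule k H e).

HB.instance Definition _ := GRing.Zmodule.copy kL {ffun Lclass E e -> k^o}.

Definition Lbasis (x : Lclass E e) : {ffun Lclass E e -> k^o} := basis k x.

(** [insub y] is [Some] of [y] when [y] lies in the class, [None] otherwise. *)
Definition LclassModule_scale : kS -> kL -> kL :=
  bilext (fun (s : S) (x : Lclass E e) =>
    if insub (s * val x)%g is Some y then Lbasis y else 0).

Fact LclassModule_scalerA a b v :
  LclassModule_scale a (LclassModule_scale b v) = LclassModule_scale (a * b) v.
Proof.
apply/esym; apply: bilextA => s t x; rewrite /sgelt /Lbasis bilext_basis.
case: (insubP (Lclass E e) (t * val x)%g) => [y tx vy|tx].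
  by rewrite bilext_basis vy mulgA.
rewrite linear0; case: insubP => //= z /(star_eq H) stx _.
case/negP: tx; apply/(star_eq H); apply: (star_suffix H (a := s));
  rewrite ?(starE H) ?mulgA //.
have /(star_eq H) <- := valP x.
by rewrite -mulgA (mul_star H).
Qed.

Fact LclassModule_scalerDr : right_distributive LclassModule_scale +%R.
Proof. by move=> a u v; rewrite /LclassModule_scale linearD. Qed.

Fact LclassModule_scalerDl v : {morph LclassModule_scale^~ v : a b / a + b}.
Proof. by move=> a b; rewrite /LclassModule_scale bilextDl. Qed.

Lemma LclassModule_scale_plus (x : Lclass E e) :
  LclassModule_scale (sgelt k H (plus E (val x))) (Lbasis x) = Lbasis x.
Proof.
by rewrite /LclassModule_scale bilext_basis (plus_mul H) valK.
Qed.

Fact LclassModule_scale1r : left_id 1 LclassModule_scale.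
Proof.
move=> v; rewrite (basis_sum v) /LclassModule_scale linear_sum /=.
apply: eq_bigr => x _; rewrite linearZ /=; congr (_ *: _).
rewrite -[bilext _ _ _]/(LclassModule_scale 1 (Lbasis x)).
rewrite -[Lbasis x]LclassModule_scale_plus LclassModule_scalerA mul1r.
exact: LclassModule_scale_plus.
Qed.

HB.instance Definition _ := GRing.Zmodule_isLmodule.Build kS kL
  LclassModule_scalerA LclassModule_scale1r LclassModule_scalerDr LclassModule_scalerDl.

End LclassModule.

(* Main.v *)
Require Import Defs.
From mathcomp Require Import all_boot all_order all_algebra.
From HB Require Import structures.
Import GRing.Theory.
Local Open Scope ring_scope.

(** The isomorphism sends a basis element [x] of the L-class module to the
    morphism [mor x].  Two facts make it work.

    The morphisms below [s] for the relation [trianglel] are the [s * star c],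
    so each is determined by its domain.  In [phi s * mor x] at most one of them
    is composable with [mor x], namely the one with domain [plus x], which is
    [s * plus x], and it contributes [mor (s * x)].  It does occur exactly when
    [star (s * plus x) = plus x], and by the congruence condition and the
    generalized right ample identity this is equivalent to
    [star (s * x) = star x], that is, to [s * x] staying in the L-class of [x]
    ([phi_mul_mor]).  Hence the linear extension [Lext] of [x |-> mor x] is
    equivariant ([Lext_scale]).

    In the category algebra, right multiplication by [mor e] keeps the
    coefficients of the morphisms of domain [e] and kills the others.  So reading
    these coefficients off, [Lres], is a left inverse of [Lext], and
    [Lext \o Lres] is the projection [y |-> y * mor e] onto the left ideal
    ([LresK], [Lext_Lres]).  This identifies the L-class module with the left
    ideal.

    The other two claims follow by transport along the bijection [phi].  The
    [mor e] with [e] in [E] are orthogonal idempotents of sum [1], so the L-class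
    modules are retracts of the regular module, hence projective, and their direct
    sum is the regular module. *)

(** If [p] splits over [i], a linear map from [M] is determined by its
    value at [p 1], and [m] acts on a lift of this value through the scalar
    [i m]. *)
Lemma retract_regular_projective (R : pzRingType) (M : lmodType R)
    (p : {linear R^o -> M}) (i : {linear M -> R^o}) :
  cancel i p -> projective M.
Proof.
move=> iK N N' g f gsurj; have [n gn] := gsurj (f (p 1)).
pose h (m : M) : N := (i m : R) *: n.
have h_lin : linear h.
  by move=> a u v; rewrite /h linearP scalerDl -scalerA.
pose hL := GRing.isLinear.Build R M N *:%R h h_lin.
exists (HB.pack_for {linear M -> N} h hL) => m /=.
rewrite /h linearZ /= gn -!linearZ /= -[in RHS](iK m).
by congr (f (p _)); apply: mulr1.
Qed.

Section LclassIdeal.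
Variables (k : fieldType) (S : finSemigroupType) (E : {set S}).
Variable H : admissible E.
Local Notation kS := (semialg k H).
Local Notation kC := (catalg k H).
Local Notation kL := (LclassModule k H).
Local Notation star := (star E).
Local Notation plus := (plus E).
Local Notation phi := (phi k H).
Local Notation mor := (mor k H).

Lemma mor_mul (a b : S) :
  mor a * mor b = if star a == plus b then mor (a * b)%g else 0.
Proof. exact: bilext_basis. Qed.

Lemma LclassP (e : S) (eE : e \in E) (x : S) :
  reflect (star x = e) (tildeL E x e).
Proof.
by apply: (iffP idP) => [/(star_eq H)|xe]; [|apply/(star_eq H)];
  rewrite (star_id H eE).
Qed.

(** The generalized right ample identity enters through [trianglel_split]:
    when [star (s * a) = star a], splitting [s * a], which lies below itself,
    gives the composable pair [(s * plus a, a)]. *)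
Lemma star_mul_plus (s a : S) :
  (star (s * plus a)%g == plus a) = (star (s * a)%g == star a).
Proof.
apply/eqP/eqP => [sa|sa].
  by rewrite -{1}(plus_mul H a) mulgA (star_comp H).
have [|] := trianglel_split H (a := s) (b := a) (x := (s * a)%g).
  by apply/(trianglelP H); rewrite (mul_star H).
by rewrite sa (mul_star H).
Qed.

(** Among the morphisms below [s], only [mor (s * plus a)] can be composed with
    [mor a]; it is composable when its domain really is [plus a]. *)
Lemma phi_mul_mor (s a : S) :
  phi (sgelt k H s) * mor a =
    if star (s * a)%g == star a then mor (s * a)%g else 0.
Proof.
rewrite phi_sgelt mulr_suml -star_mul_plus.
under eq_bigr => c _ do rewrite mor_mul.
rewrite -big_mkcondr /=.
case: eqP => [sa|sa].
  rewrite (big_pred1 (s * plus a)%g) => [|c].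
    by rewrite -mulgA (plus_mul H).
  apply/andP/eqP => [[/(trianglelP H) cs /eqP ca]|->]; first by rewrite cs ca.
  by split; [apply/(trianglelP H); rewrite sa | apply/eqP].
rewrite big_pred0 // => c; apply/negP => /andP[/(trianglelP H) cs /eqP ca].
by apply: sa; rewrite -ca -cs.
Qed.

Arguments LclassP {e} eE {x}.

Section OneClass.
Variable e : S.

Definition Lext (v : kL e) : kC := linext (fun x : Lclass E e => mor (val x)) v.

Definition Lres (y : kC) : kL e := [ffun x : Lclass E e => y (val x)].

Lemma Lext_additive : {morph Lext : u v / u + v}.
Proof. by move=> u v; rewrite /Lext linearD. Qed.

Lemma LextE (v : kL e) (b : S) :
  Lext v b = if insub b is Some x then v x else 0.
Proof.
rewrite [LHS]sum_ffunE; case: insubP => [x _ <-|nb].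
  rewrite (bigD1 x) //= big1 ?addr0 => [|z zx]; rewrite !ffunE.
    by rewrite eqxx /GRing.scale /= mulr1.
  by rewrite eq_sym (inj_eq val_inj) (negPf zx) /GRing.scale /= mulr0.
rewrite big1 // => z _; rewrite !ffunE.
case: eqP => [bz|_]; last by rewrite /GRing.scale /= mulr0.
by rewrite bz (valP z) in nb.
Qed.

Lemma LresK : cancel Lext Lres.
Proof. by move=> v; apply/ffunP => x; rewrite ffunE LextE valK. Qed.

Hypothesis eE : e \in E.

Lemma mor_idem : mor e * mor e = mor e.
Proof. by rewrite mor_mul (star_id H) // (plus_id H) // eqxx (adm_idem H). Qed.

Lemma mul_mor (y : kC) (b : S) : (y * mor e) b = if star b == e then y b else 0.
Proof.
have -> : y * mor e = \sum_(a | star a == e) y a *: mor a.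
  rewrite [LHS]bilextl [RHS]big_mkcond; apply: eq_bigr => a _ /=.
  rewrite linext_basis (plus_id H) //.
  by case: eqP => [<-|_]; rewrite ?(mul_star H) ?scaler0.
rewrite sum_ffunE; case: ifP => be.
  rewrite (bigD1 b) //= big1 ?addr0 => [|a /andP[_ ab]]; rewrite !ffunE.
    by rewrite eqxx /GRing.scale /= mulr1.
  by rewrite eq_sym (negPf ab) /GRing.scale /= mulr0.
rewrite big1 // => a ae; rewrite !ffunE.
case: eqP => [ba|_]; last by rewrite /GRing.scale /= mulr0.
by rewrite ba ae in be.
Qed.

Lemma Lext_Lres (y : kC) : Lext (Lres y) = y * mor e.
Proof.
apply/ffunP => b; rewrite LextE mul_mor.
case: insubP => [x /(LclassP eE) -> <-|/negP nb]; first by rewrite eqxx ffunE.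
by case: eqP => // be; case: nb; apply/(LclassP eE).
Qed.

Lemma Lext_scale (s : kS) (v : kL e) : Lext (s *: v) = phi s * Lext v.
Proof.
rewrite -[s *: v]/(bilext _ s v) -[phi s * _]/(bilext _ _ _).
rewrite (basis_sum s) bilext_suml /Lext /Defs.phi !linext_sum bilext_suml.
apply: eq_bigr => a _; congr (_ *: _).
rewrite (basis_sum v) bilext_sumr !linext_sum bilext_sumr.
apply: eq_bigr => x _; congr (_ *: _).
rewrite bilext_basis.
have /(LclassP eE) xe := valP x.
transitivity (phi (sgelt k H a) * mor (val x)); last first.
  by rewrite phi_sgelt !linext_basis.
rewrite phi_mul_mor xe.
case: insubP => [y /(LclassP eE) -> <-|/negP nL].
  by rewrite eqxx linext_basis.
rewrite linear0; case: eqP => // /(LclassP eE); by move/nL.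
Qed.

(** [Lext] is injective and equivariant, and [Lext \o Lres] is a right
    multiplication, so it commutes with the left action: [Lres] inherits
    equivariance. *)
Lemma Lres_phi_scale (s : kS) (y : kC) : Lres (phi s * y) = s *: Lres y.
Proof.
by apply: (can_inj LresK); rewrite Lext_scale !Lext_Lres mulrA.
Qed.

Lemma Lres_additive : {morph Lres : y z / y + z}.
Proof. by move=> y z; apply/ffunP => x; rewrite !ffunE. Qed.

End OneClass.

Lemma phi_regular (a : kS) (s t : kS^o) :
  phi (a *: s + t) = phi a * phi s + phi t.
Proof. by rewrite linearD; congr (_ + _); apply: phi_semialg_mul. Qed.

Definition phi_inv (y : kC) : kS := xchoose (phi_surj y).

Lemma phi_invK : cancel phi_inv phi.
Proof. by move=> y; apply/eqP/(xchooseP (phi_surj y)). Qed.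

Lemma phiK : cancel phi phi_inv.
Proof. by move=> s; apply: (@phi_inj k S E H); rewrite phi_invK. Qed.

Lemma Lclass_iso_left_ideal (e : S) : e \in E ->
  lmod_iso (kL e) (restrict phi (left_ideal (mor e))).
Proof.
move=> eE.
have Lext_ideal v : Lext e v \in left_ideal_pred (mor e).
  by apply/boolp.asboolP; exists (Lext e v); rewrite -Lext_Lres // LresK.
pose f v : restrict phi (left_ideal (mor e)) := LeftIdeal (Lext_ideal v).
have f_lin : linear f.
  move=> a u v; apply: val_inj.
  by rewrite /= Lext_additive Lext_scale.
exists (HB.pack_for {linear kL e -> restrict phi (left_ideal (mor e))} f
  (GRing.isLinear.Build kS _ _ *:%R f f_lin)) => /=.
exists (fun y => Lres e (val (y : left_ideal (mor e)))) => [v|y].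
  exact: LresK.
apply: val_inj => /=; rewrite Lext_Lres //.
have /boolp.asboolP[z ->] := valP (y : left_ideal (mor e)).
by rewrite -mulrA mor_idem.
Qed.

Lemma Lclass_projective (e : S) : e \in E -> projective (kL e).
Proof.
move=> eE.
pose p (s : kS^o) : kL e := Lres e (phi s).
pose i (v : kL e) : kS^o := phi_inv (Lext e v).
have p_lin : linear p.
  move=> a s t.
  by rewrite /p phi_regular Lres_additive Lres_phi_scale.
have i_lin : linear i.
  move=> a u v; apply: (@phi_inj k S E H).
  rewrite /i phi_regular !phi_invK Lext_additive Lext_scale //.
pose pL := HB.pack_for {linear kS^o -> kL e} p
  (GRing.isLinear.Build kS _ _ *:%R p p_lin).
pose iL := HB.pack_for {linear kL e -> kS^o} i
  (GRing.isLinear.Build kS _ _ *:%R i i_lin).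
apply: (@retract_regular_projective _ _ pL iL) => v.
by rewrite /= /p phi_invK LresK.
Qed.

Lemma sum_mul_mor (y : kC) : \sum_(e : {e | e \in E}) y * mor (val e) = y.
Proof.
rewrite -mulr_sumr -[RHS]mulr1; congr (y * _).
exact: (esym (big_sub [in E] mor)).
Qed.

Lemma Lres_Lext_neq (e e' : S) (v : kL e) :
  e \in E -> e' \in E -> e' != e -> Lres e' (Lext e v) = 0.
Proof.
move=> eE e'E ne; apply/ffunP => x; rewrite !ffunE LextE.
case: insubP => // z /(LclassP eE) xe _.
by have /(LclassP e'E) xe' := valP x; rewrite -xe' xe eqxx in ne.
Qed.

Lemma regular_iso_dsum :
  lmod_iso (kS^o) (dsum (fun e : {e : S | e \in E} => kL (val e))).
Proof.
pose D := dsum (fun e : {e : S | e \in E} => kL (val e)).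
pose f (s : kS^o) : D := [ffun e => Lres (val e) (phi s) : kL (val e)].
have f_lin : linear f.
  move=> a s t; apply/ffunP => e; rewrite !ffunE.
  by rewrite phi_regular Lres_additive Lres_phi_scale // (valP e).
exists (HB.pack_for {linear kS^o -> D} f
  (GRing.isLinear.Build kS _ _ *:%R f f_lin)) => /=.
exists (fun u : D => phi_inv (\sum_e Lext (val e) (u e))) => [s|u].
  rewrite -[RHS]phiK; congr phi_inv; rewrite -[RHS]sum_mul_mor.
  by apply: eq_bigr => e _; rewrite ffunE Lext_Lres // (valP e).
apply/ffunP => e; rewrite ffunE phi_invK.
rewrite (big_morph _ (@Lres_additive _) (_ : Lres _ 0 = 0)); last first.
  by apply/ffunP => x; rewrite !ffunE.
rewrite (bigD1 e) //= LresK big1 ?addr0 // => e' ne.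
by rewrite Lres_Lext_neq ?(valP e) ?(valP e') // (inj_eq val_inj) eq_sym.
Qed.

End LclassIdeal.

Theorem theorem3p11 (k : fieldType) (S : finSemigroupType) (E : {set S})
    (H : admissible E) :
  [/\ forall e : S, e \in E ->
        lmod_iso (LclassModule k H e) (restrict (phi k H) (left_ideal (mor k H e))),
      forall e : S, e \in E -> projective (LclassModule k H e)
    & lmod_iso (semialg k H)^o
        (dsum (fun e : {e : S | e \in E} => LclassModule k H (val e)))].
Proof.
split=> [e|e|].
- exact: Lclass_iso_left_ideal.
- exact: Lclass_projective.
- exact: regular_iso_dsum.
Qed.
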